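(* Let $\varepsilon>0$ be fixed. Let $p$ be a prime, let $\mathcal H=\{1,\ldots,H\}$ be an initial interval of $H\ge 1$ consecutive integers, and let $\mathcal M\subseteq \mathbb F_p^*$ be a set of cardinality $\#\mathcal M=M$. Assume that either $$H\ge p^{2/3},\qquad HM\ge p^{1+\varepsilon},$$ or $$H<p^{2/3},\qquad M\ge p^{1/3},\qquad HM^{1/4}\ge p^{3/4+\varepsilon}.$$ Then there is some $\eta>0$, depending only on $\varepsilon$, such that $$\#\left(\mathcal H\mathcal M\right)=p+O\left(p^{1-\eta}\right),$$ where $\mathcal H\mathcal M=\{hm:\ h\in\mathcal H,\ m\in\mathcal M\}$ is considered as a subset of $\mathbb F_p$.
   Context: $p$ denotes a (large) prime, $\mathbb F_p$ is the field of residue classes modulo $p$, and $\mathbb F_p^*$ is its set of non-zero elements. Integers are identified with their residue classes modulo $p$ when multiplied by elements of $\mathbb F_p$. $U=O(V)$ means $|U|\le cV$ for some constant $c>0$; here $c$ may depend only on $\varepsilon$ (it is uniform in $p$, $H$ and $\mathcal M$). *)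

(* Defs.v *)
From mathcomp Require Import all_boot all_order all_algebra.
From mathcomp Require Import reals exp.

Set Implicit Arguments.
Unset Strict Implicit.
Unset Printing Implicit Defensive.

Import Order.TTheory GRing.Theory Num.Theory.
Local Open Scope ring_scope.

(* The image in 'F_p of {h m : 1 <= h <= H, m in M}; since h%:R reduces the
   integer h modulo p, H is not required to be smaller than p. *)
Definition interval_prodset (p H : nat) (M : {set 'F_p}) : {set 'F_p} :=
  [set (h : nat)%:R * m | h : 'I_H.+1, m : 'F_p in M & (1 <= h)%N].

(* Main.v *)
Require Import Defs.
From mathcomp Require Import all_boot all_order all_algebra.
From mathcomp Require Import reals exp trigo.
From mathcomp Require Import ring lra zify.

Set Implicit Arguments.
Unset Strict Implicit.
Unset Printing Implicit Defensive.

Import Order.TTheory GRing.Theory Num.Theory.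
Local Open Scope ring_scope.

(** Let X be the complement of the product set.  No quotient x / m with x in X
    and m in M is congruent to an integer of [1, H], and the task is to show that
    this forces X to be small.

    Fourier analysis turns it into a counting problem.  There is a real
    trigonometric polynomial with O(p / H) frequencies, bounded coefficients and
    constant term at least 1 that is nonpositive off the arc corresponding to
    [1, H] ([fejer_minorant]): a squared Fejer kernel times a shifted cosine.
    Summing it over all x / m, and using Cauchy-Schwarz and Parseval, gives
    #X #M^2 = O(p E) ([uncovered_leq]), where E is the number of solutions of
    a m' = a' m with positive integers a, a' < A = O(p / H) and m, m' in M.  So it
    suffices to prove that E is smaller than #M^2 by a power of p.

    The energy E counts edges of a graph on M.  Cauchy-Schwarz bounds the square
    of E by #M times the number of paths of length two; the ends m1, m2 of such a
    path satisfy m1 u = m2 v with u, v < A^2, and up to the divisor bound the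
    path is determined by m1, m2, u and v ([path_count_leq]).  The solutions (u, v)
    of a congruence lam u = v in a box of side A^2 <= p lie on few parallel lines, and
    their number is O(A^4 / p + A + A r), where r is the number of solutions in
    the smaller box of side A ([ratio_count_sqr]).  Summed over m1 / m2, the last
    term reproduces A E, so that up to the divisor bound
      E^2 <= #M (#M^2 (A^4 / p + A) + A E)     ([energy_sqr_leq]).
    Hence E / #M^2 is at most about the square root of A^4 / (p #M) + A / #M.
    In both ranges of the theorem H #M >= p^(1 + eps) and H^4 #M >= p^(3 + eps)
    ([range_consequences]), so both terms are O(p^(-eps)). *)

(** * The divisor bound *)

Lemma size_divisorsM_leq (m n : nat) : (0 < m)%N -> (0 < n)%N ->
  (size (divisors (m * n)) <= size (divisors m) * size (divisors n))%N.
Proof.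
move=> m0 n0; rewrite -(size_allpairs muln).
apply: uniq_leq_size; first exact: divisors_uniq.
move=> d; rewrite -dvdn_divisors ?muln_gt0 ?m0 // => dmn.
(* d = g * (d / g) with g = gcd(d, m), and d / g is coprime to m / g. *)
have g0 : (0 < gcdn d m)%N by rewrite gcdn_gt0 m0 orbT.
apply/allpairsP; exists (gcdn d m, d %/ gcdn d m)%N => /=.
rewrite -!dvdn_divisors // dvdn_gcdr mulnC divnK ?dvdn_gcdl //; split=> //.
have cop : coprime (d %/ gcdn d m) (m %/ gcdn d m).
  by rewrite /coprime -(eqn_pmul2r g0) muln_gcdl mul1n !divnK ?dvdn_gcdl ?dvdn_gcdr.
rewrite -(Gauss_dvdr _ cop) -(dvdn_pmul2r g0) divnK ?dvdn_gcdl //.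
by rewrite mulnAC divnK ?dvdn_gcdr.
Qed.

Lemma size_divisors_pfactor_leq (q e : nat) : prime q ->
  (size (divisors (q ^ e)) <= e.+1)%N.
Proof.
move=> qP; rewrite -[leqRHS](size_iota 0) -[leqRHS](size_map (expn q)).
apply: uniq_leq_size => [|d]; first exact: divisors_uniq.
rewrite -dvdn_divisors ?expn_gt0 ?prime_gt0 // => /dvdn_pfactor[] // i ie ->.
by apply: map_f; rewrite mem_iota ltnS.
Qed.

(** Cut e into k pieces and use t + 1 <= 2 ^ t on one of them. *)
Lemma expn_succ_leq (k e : nat) : (0 < k)%N -> (e.+1 ^ k <= k ^ k * 2 ^ e)%N.
Proof.
move=> k0; have : (e.+1 <= k * 2 ^ (e %/ k))%N.
  apply: (@leq_trans (k * (e %/ k).+1)); first by rewrite mulnC ltn_ceil.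
  by rewrite leq_mul2l ltn_expl ?orbT.
rewrite -(leq_exp2r _ _ k0) => /leq_trans; apply.
by rewrite expnMn leq_mul2l -expnM leq_exp2l // leq_divM orbT.
Qed.

(** One prime at a time: splitting off the q-part of n costs a factor K as soon
    as (e + 1) ^ k <= K q ^ e for all e. *)
Lemma size_divisors_strip (k q K n : nat) : (0 < k)%N -> prime q -> (0 < n)%N ->
  (forall e, e.+1 ^ k <= K * q ^ e)%N ->
  exists m, [/\ (0 < m)%N, (m %| n)%N, ~~ (q %| m)%N & forall C,
    (size (divisors m) ^ k <= C * m)%N ->
    (size (divisors n) ^ k <= K * C * n)%N].
Proof.
move=> k0 qP n0 hK; have [m qm nE] := pfactor_coprime qP n0.
have m0 : (0 < m)%N by move: n0; rewrite nE muln_gt0 => /andP[].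
have q0 e : (0 < q ^ e)%N by rewrite expn_gt0 prime_gt0.
exists m; rewrite -prime_coprime // qm nE dvdn_mulr //; split=> // C hC.
rewrite -nE {1 2}nE; set e := logn q n.
apply: (@leq_trans (size (divisors m) ^ k * e.+1 ^ k)).
  rewrite -expnMn leq_exp2r //.
  apply: leq_trans (size_divisorsM_leq m0 (q0 _)) _.
  by rewrite leq_mul2l size_divisors_pfactor_leq ?orbT.
by rewrite [leqRHS](_ : _ = C * m * (K * q ^ e))%N ?leq_mul //; lia.
Qed.

(** For a prime q >= 2 ^ k one has (e + 1) ^ k <= 2 ^ (e k) <= q ^ e, so such
    primes are stripped for free; each of the at most 2 ^ k smaller ones costs
    the constant of [expn_succ_leq]. *)
Lemma divisor_bound (k : nat) : (0 < k)%N ->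
  exists2 C : nat, (0 < C)%N &
  forall n, (0 < n)%N -> (size (divisors n) ^ k <= C * n)%N.
Proof.
move=> k0; set K := (k ^ k)%N.
have K0 : (0 < K)%N by rewrite expn_gt0 k0.
suff main j n : (0 < n)%N ->
    (forall q, prime q -> q %| n -> 2 ^ k - j <= q)%N ->
    (size (divisors n) ^ k <= K ^ j * n)%N.
  exists (K ^ (2 ^ k))%N => [|n n0]; first by rewrite expn_gt0 K0.
  by apply: main => // q _ _; rewrite subnn.
elim: j n => [|j IHj] n n0 hn.
  elim/ltn_ind: n n0 hn => n IHn n0 hn.
  have [n1|n1] := leqP n 1.
    by rewrite (_ : n = 1)%N ?exp1n //; lia.
  have qP := pdiv_prime n1; set q := pdiv n in qP.
  have qge : (2 ^ k <= q)%N by rewrite -[leqLHS]subn0 hn ?pdiv_dvd.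
  have hq e : (e.+1 ^ k <= 1 * q ^ e)%N.
    rewrite mul1n; apply: (@leq_trans ((2 ^ k) ^ e)).
      by rewrite -expnM mulnC expnM leq_exp2r // ltn_expl.
    by case: e => // e; rewrite leq_exp2r.
  have [m [m0 mn qm]] := size_divisors_strip k0 qP n0 hq.
  move=> /(_ (K ^ 0)%N); rewrite mul1n; apply.
  apply: IHn => // [|r rP rm]; last by apply: hn (dvdn_trans rm mn).
  rewrite ltn_neqAle (dvdn_leq n0 mn) andbT.
  by apply: contraNneq qm => ->; apply: pdiv_dvd.
have hr r : prime r -> (r %| n)%N -> r <> (2 ^ k - j.+1)%N -> (2 ^ k - j <= r)%N.
  by move=> rP rn rj; have := hn r rP rn; lia.
have [qP|qNP] := boolP (prime (2 ^ k - j.+1)%N).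
  have hq e : (e.+1 ^ k <= K * (2 ^ k - j.+1) ^ e)%N.
    apply: leq_trans (expn_succ_leq e k0) _; rewrite leq_mul2l; apply/orP; right.
    by case: e => // e; rewrite leq_exp2r // prime_gt1.
  have [m [m0 mn qm]] := size_divisors_strip k0 qP n0 hq.
  move=> /(_ (K ^ j)%N); rewrite -expnS; apply; apply: IHj => // r rP rm.
  apply: hr (dvdn_trans rm mn) _ => // rE.
  by move: qm; rewrite -rE rm.
apply: leq_trans (IHj n n0 _) _ => [r rP rn|].
  by apply: hr => // rE; move: qNP; rewrite -rE rP.
by rewrite leq_mul2r leq_pexp2l ?orbT.
Qed.

(** * Points of a modular line in a box *)

Definition ratio_count (p B : nat) (lam : 'F_p) : nat :=
  #|[set z : 'I_B * 'I_B |
      [&& (0 < z.1)%N, (0 < z.2)%N & lam * (z.1)%:R == (z.2)%:R]]|.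

Lemma natr_Fp_eq0 (p n : nat) : prime p -> (n%:R == 0 :> 'F_p) = (p %| n)%N.
Proof. by move=> pP; rewrite -val_eqE /= val_Fp_nat. Qed.

Lemma natr_Fp_eq (p m n : nat) : prime p ->
  m%:R = n%:R :> 'F_p -> (m %% p = n %% p)%N.
Proof. by move=> pP /(congr1 (@nat_of_ord _)); rewrite !(val_Fp_nat pP). Qed.

Lemma coprime_lin_mod (x y a b a' b' : nat) : coprime x y ->
  (x * a + y * b = x * a' + y * b')%N -> (b = b' %[mod x])%N.
Proof.
move=> cxy; wlog le_b : a b a' b' / (b <= b')%N => [th E|].
  case: (leqP b b') => [|/ltnW] le; first exact: th le E.
  by symmetry; apply: th le (esym E).
move=> E; apply/esym/eqP; rewrite eqn_mod_dvd // -(Gauss_dvdr _ cxy).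
by apply/dvdnP; exists (a - a')%N; nia.
Qed.

(** On each line [x a + y b = const] the coprimality of [x] and [y] spaces the
    values of [b] by multiples of [x], so that [b / x] tells its points apart;
    a residue condition modulo [p] leaves [K] such lines. *)
Lemma card_parallel_lines (T : finType) (P : {set T}) (a b : T -> nat)
    (x y p c k0 K B : nat) : coprime x y -> (0 < x)%N ->
  {in P &, forall z z', a z = a z' -> b z = b z' -> z = z'} ->
  {in P, forall z, b z <= B}%N ->
  {in P, forall z, (x * a z + y * b z) %% p = c}%N ->
  {in P, forall z, k0 <= (x * a z + y * b z) %/ p < k0 + K}%N ->
  (#|P| <= K * (B %/ x).+1)%N.
Proof.
move=> cxy x0 inj_ab leB res key.
pose f z := (((x * a z + y * b z) %/ p - k0)%N, (b z %/ x)%N).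
have fI : {in P &, injective f}.
  move=> z z' zP z'P [E1 E2].
  have E : (x * a z + y * b z = x * a z' + y * b z')%N.
    rewrite (divn_eq (x * a z + _) p) (divn_eq (x * a z' + _) p) !res //.
    congr (_ * _ + _)%N; move: (key _ zP) (key _ z'P) E1; lia.
  have Eb : b z = b z'.
    by rewrite (divn_eq (b z) x) (divn_eq (b z') x) E2 (coprime_lin_mod cxy E).
  apply: inj_ab => //; apply/eqP; rewrite -(eqn_pmul2l x0); apply/eqP.
  by move: E; rewrite Eb => /addIn.
have -> : #|P| = size [seq f z | z <- enum P] by rewrite size_map -cardE.
have -> : (K * (B %/ x).+1)%N =
    size [seq (i, j) | i <- iota 0 K, j <- iota 0 (B %/ x).+1].
  by rewrite size_allpairs !size_iota.
apply: uniq_leq_size.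
  rewrite map_inj_in_uniq ?enum_uniq // => z z'; rewrite !mem_enum; exact: fI.
move=> _ /mapP[z zP ->]; rewrite mem_enum in zP.
apply: allpairs_f; rewrite mem_iota.
  by move: (key _ zP); lia.
by rewrite ltnS leq_div2r ?leB.
Qed.

(** Thue's lemma: by the pigeonhole principle two of the more than [p] values
    [lam i - j] agree, and a common factor of the differences cancels. *)
Lemma Fp_small_ratio (p s : nat) (lam : 'F_p) : prime p -> lam != 0 ->
  (s < p)%N -> (p < s.+1 ^ 2)%N ->
  exists x y : nat, [/\ (0 < x <= s)%N, (0 < y <= s)%N, coprime x y &
    lam * x%:R = y%:R \/ lam * x%:R = - y%:R].
Proof.
move=> pP lam0 sp ps.
have smallN0 n : (0 < n)%N -> (n <= s)%N -> n%:R != 0 :> 'F_p.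
  move=> n0 ns; rewrite natr_Fp_eq0 //; apply/negP => /dvdn_leq; lia.
suff [x [y [x0 xs ys E]]] : exists x y : nat, [/\ (0 < x)%N, (x <= s)%N,
    (y <= s)%N & lam * x%:R = y%:R \/ lam * x%:R = - y%:R].
  have y0 : (0 < y)%N.
    case: (posnP y) E => // ->; rewrite oppr0 => E.
    have /eqP : lam * x%:R = 0 by case: E.
    by rewrite mulf_eq0 (negPf lam0) (negPf (smallN0 _ x0 xs)).
  have g0 : (0 < gcdn x y)%N by rewrite gcdn_gt0 x0.
  have [gx gy] := (dvdn_gcdl x y, dvdn_gcdr x y).
  have gs : (gcdn x y <= s)%N by apply: leq_trans (dvdn_leq x0 gx) xs.
  exists (x %/ gcdn x y)%N, (y %/ gcdn x y)%N.
  rewrite !divn_gt0 // !(dvdn_leq _ gx) ?(dvdn_leq _ gy) //.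
  rewrite !(leq_trans (leq_div _ _)) //; split=> //.
    by rewrite /coprime -(eqn_pmul2r g0) muln_gcdl mul1n !divnK.
  have gN0 := smallN0 _ g0 gs.
  case: E => E; [left|right]; apply: (mulIf gN0);
    by rewrite ?mulNr -mulrA -!natrM !divnK.
pose f (z : 'I_s.+1 * 'I_s.+1) : 'F_p := lam * (z.1)%:R - (z.2)%:R.
have /injectivePn[z [z' zz' E]] : ~~ injectiveb f.
  apply/negP => /injectiveP/leq_card; rewrite card_prod !card_ord Fp_cast //.
  by rewrite leqNgt ps.
wlog lt_z : z z' zz' E / (z'.1 <= z.1)%N => [th|].
  case: (leqP z'.1 z.1) => [|/ltnW] le; first exact: th zz' E le.
  by rewrite eq_sym in zz'; apply: th zz' (esym E) le.
have E' : lam * (z.1 - z'.1)%:R = (z.2)%:R - (z'.2)%:R.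
  rewrite natrB // mulrBr -[lam * (z.1)%:R](subrK (z.2)%:R) -/(f z) E /f.
  by rewrite addrC !addrA addNr add0r addrC.
have [u1 u2] : (z.2 <= s)%N /\ (z'.2 <= s)%N by split; rewrite -ltnS.
have v1 : (z.1 <= s)%N by rewrite -ltnS.
have hx : (0 < z.1 - z'.1)%N.
  rewrite lt0n; apply: contra zz' => /eqP x0; move: E'; rewrite x0 mulr0.
  move/esym/eqP; rewrite subr_eq0 => /eqP/(natr_Fp_eq pP).
  rewrite !modn_small; try lia; move=> e2.
  apply/eqP; case: z z' {E lt_z u1 u2 v1} x0 e2 lt_z => [z1 z2] [w1 w2] /= x0 e2 lt_z.
  by congr pair; apply: val_inj => /=; lia.
exists (z.1 - z'.1)%N; rewrite E'.
case: (leqP z'.2 z.2) => [le2|/ltnW le2].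
  by exists (z.2 - z'.2)%N; split=> //; [lia|lia|left; rewrite natrB].
by exists (z'.2 - z.2)%N; split=> //; [lia|lia|right; rewrite natrB // opprB].
Qed.

Section ModularLine.

Variables (p : nat) (lam : 'F_p) (x y B : nat).
Hypotheses (x_gt0 : (0 < x)%N) (y_gt0 : (0 < y)%N).

(** The multiples of [(x, y)] inside the box. *)
Lemma ratio_count_multiples (A : nat) : lam * x%:R = y%:R ->
  (A.-1 %/ maxn x y <= ratio_count A lam)%N.
Proof.
move=> lamE; set q := (A.-1 %/ maxn x y)%N.
have l0 : (0 < maxn x y)%N by rewrite leq_max x_gt0.
have small (k : 'I_q) c : (c <= maxn x y)%N -> (k.+1 * c < A)%N.
  move=> cl; have := ltn_ord k; rewrite -/q => kq.
  have h1 : (k.+1 * c <= q * maxn x y)%N by apply: leq_mul.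
  have h2 := leq_divM A.-1 (maxn x y).
  have h3 : (0 < A)%N.
    by have := leq_div A.-1 (maxn x y); rewrite -/q; lia.
  by rewrite -/q in h2; lia.
pose f (k : 'I_q) : 'I_A * 'I_A :=
  (Ordinal (small k x (leq_maxl _ _)), Ordinal (small k y (leq_maxr _ _))).
have fI : injective f.
  move=> k k' [/eqP]; rewrite eqn_pmul2r // => /eqP[E] _; exact: val_inj.
rewrite -[q]card_ord -(card_codom fI); apply: subset_leq_card.
apply/subsetP => _ /codomP[k ->]; rewrite inE /= !muln_gt0 x_gt0 y_gt0 /=.
by rewrite !natrM -lamE; apply/eqP; ring.
Qed.

Hypotheses (pP : prime p) (cxy : coprime x y).

(** Both coordinates can serve to separate points on a line; the larger
    coefficient gives the better spacing. *)
Lemma ratio_count_neg : lam * x%:R = - y%:R ->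
  (ratio_count B lam <= ((maxn x y * B).*2 %/ p) * (B %/ maxn x y).+1)%N.
Proof.
move=> lamE; pose P := [set z : 'I_B * 'I_B |
  [&& (0 < z.1)%N, (0 < z.2)%N & lam * (z.1)%:R == (z.2)%:R]].
have res : {in P, forall z : 'I_B * 'I_B, (x * z.2 + y * z.1) %% p = 0}%N.
  move=> z; rewrite inE => /and3P[_ _ /eqP E].
  apply/eqP; rewrite -[_ == _]/(p %| _)%N -natr_Fp_eq0 // natrD !natrM -E.
  by rewrite mulrA (mulrC x%:R) lamE mulNr addNr.
have key : {in P, forall z : 'I_B * 'I_B, 1 <= (x * z.2 + y * z.1) %/ p
    < 1 + (maxn x y * B).*2 %/ p}%N.
  move=> z zP; have := zP; rewrite inE => /and3P[z1 z2 _].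
  rewrite divn_gt0 ?prime_gt0 // dvdn_leq ?addn_gt0 ?muln_gt0 ?x_gt0 ?z2 //=; last first.
    by rewrite /dvdn res.
  rewrite add1n ltnS leq_div2r // -addnn; apply: leq_add; apply: leq_mul.
  - exact: leq_maxl.
  - exact: ltnW.
  - exact: leq_maxr.
  - exact: ltnW.
have [yx|xy] := leqP y x.
  rewrite (maxn_idPl yx) in key *.
  apply: (card_parallel_lines (P := P) (a := fun z => z.2)
    (b := fun z => z.1) cxy x_gt0 _ _ res key)
    => [z z' _ _ /val_inj E1 /val_inj E2|z _]; last exact: ltnW.
  by case: z z' E1 E2 => [? ?] [? ?] /= -> ->.
rewrite (maxn_idPr (ltnW xy)) in key *.
have cyx : coprime y x by rewrite coprime_sym.
apply: (card_parallel_lines (P := P) (a := fun z => z.1)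
  (b := fun z => z.2) (p := p) (c := 0%N) (k0 := 1%N) cyx y_gt0).
- by move=> [? ?] [? ?] _ _ /= /val_inj -> /val_inj ->.
- by move=> z _; apply: ltnW.
- by move=> z zP; rewrite addnC res.
- by move=> z zP; rewrite addnC key.
Qed.

(** Reflecting one coordinate turns [x v = y u] into an equation
    [x v + y u' = y B] with positive coefficients. *)
Lemma ratio_count_pos : lam * x%:R = y%:R ->
  (ratio_count B lam <=
     ((maxn x y * B).*2 %/ p).+1 * (B %/ maxn x y).+1)%N.
Proof.
move=> lamE; pose P := [set z : 'I_B * 'I_B |
  [&& (0 < z.1)%N, (0 < z.2)%N & lam * (z.1)%:R == (z.2)%:R]].
have zE z : z \in P -> x%:R * (z.2)%:R = y%:R * (z.1)%:R :> 'F_p.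
  by rewrite inE => /and3P[_ _ /eqP <-]; rewrite -lamE; ring.
have bnd u v w t : (u <= maxn x y)%N -> (v <= B)%N -> (w <= maxn x y)%N ->
    (t <= B)%N -> (0 <= (u * v + w * t) %/ p < 0 + ((maxn x y * B).*2 %/ p).+1)%N.
  by move=> ux vB wx tB; rewrite add0n ltnS leq_div2r // -addnn leq_add ?leq_mul.
have [yx|xy] := leqP y x.
  rewrite (maxn_idPl yx) in bnd.
  apply: (card_parallel_lines (P := P) (a := fun z => z.2)
    (b := fun z => (B - z.1)%N) (p := p) (c := (y * B %% p)%N) (k0 := 0%N)
    cxy x_gt0) => [[u v] [u' v'] _ _ /= /val_inj -> Eu|z _|z /zE Ez|z _].
  - by congr (_, _); apply: val_inj => /=; have := ltn_ord u;
      have := ltn_ord u'; lia.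
  - exact: leq_subr.
  - apply: natr_Fp_eq => //; rewrite natrD !natrM Ez natrB ?(ltnW (ltn_ord _)) //.
    ring.
  - by apply: bnd; rewrite ?leqnn ?leq_subr // ltnW.
rewrite (maxn_idPr (ltnW xy)) in bnd; have cyx : coprime y x by rewrite coprime_sym.
apply: (card_parallel_lines (P := P) (a := fun z => z.1)
  (b := fun z => (B - z.2)%N) (p := p) (c := (x * B %% p)%N) (k0 := 0%N)
  cyx y_gt0) => [[u v] [u' v'] _ _ /= /val_inj -> Ev|z _|z /zE Ez|z _].
- by congr (_, _); apply: val_inj => /=; have := ltn_ord v;
    have := ltn_ord v'; lia.
- exact: leq_subr.
- apply: natr_Fp_eq => //; rewrite natrD !natrM -Ez natrB ?(ltnW (ltn_ord _)) //.
  ring.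
- by apply: bnd; rewrite ?leqnn ?leq_subr // ltnW.
Qed.

End ModularLine.

(** A short vector [(x, y)] of length [l <= sqrt p] governs the solutions of
    [lam u = v] in the box of side [A ^ 2]: they lie on [1 + O(l A ^ 2 / p)]
    lines with [O(1 + A ^ 2 / l)] points each.  The term [A ^ 2 / l] of the line
    through the origin is at most [A] unless [l < A], and then it is
    [O(A * ratio_count A lam)] by [ratio_count_multiples]; with the sign
    [lam x = - y] that line carries no positive point. *)
Lemma ratio_count_sqr (p A : nat) (lam : 'F_p) : prime p -> lam != 0 ->
  (0 < A)%N -> (A ^ 2 <= p)%N ->
  (p * ratio_count (A ^ 2) lam
     <= 2 * A ^ 4 + 5 * (p * A) + 2 * (p * A) * ratio_count A lam)%N.
Proof.
move=> pP lam0 A0 Ap.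
have p2 := prime_gt1 pP.
have [s ps sp] : exists2 s, (p < s.+1 ^ 2)%N & (s ^ 2 <= p)%N.
  have ex : exists s, (p < s.+1 ^ 2)%N by exists p; nia.
  case: (ex_minnP ex) => s ps smin; exists s => //.
  case: s smin ps => [|s] smin _ //; rewrite leqNgt; apply/negP => /smin.
  by rewrite ltnn.
have As : (A <= s)%N by rewrite leqNgt; apply/negP => h; nia.
have ltsp : (s < p)%N by nia.
have [x [y [/andP[x0 xs] /andP[y0 ys] cxy lamE]]] :=
  Fp_small_ratio pP lam0 ltsp ps.
set l := maxn x y.
have ls : (l <= s)%N by rewrite geq_max xs.
have l0 : (0 < l)%N by rewrite leq_max x0.
have lA : (l * A <= p)%N by nia.
set B := (A ^ 2)%N; set K := ((l * B).*2 %/ p)%N; set Q := (B %/ l)%N.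
have hK : (p * K <= 2 * (l * B))%N by rewrite mulnC mul2n leq_divM.
have hQ : (Q * l <= B)%N by rewrite leq_divM.
have hKQ : (p * (K * Q.+1) <= 2 * A ^ 4 + 2 * (p * A))%N.
  have h1 : (p * (K * Q.+1) <= 2 * (l * B) * Q.+1)%N by rewrite mulnA leq_mul2r hK orbT.
  have h2 : (2 * (l * B) * Q <= 2 * A ^ 4)%N.
    by rewrite (_ : A ^ 4 = B * B)%N ?/B; nia.
  have h3 : (2 * (l * B) <= 2 * (p * A))%N 
    by rewrite leq_mul2l /B -mulnn mulnA leq_mul2r lA orbT.
  by lia.
case: lamE => lamE; last first.
  have := ratio_count_neg B x0 y0 pP cxy lamE; rewrite -/l -/K -/Q => h.
  apply: (leq_trans _ (leq_addr _ _)).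
  apply: (@leq_trans (p * (K * Q.+1))); first by rewrite leq_mul2l h orbT.
  lia.
have := ratio_count_pos B x0 y0 pP cxy lamE; rewrite -/l -/K -/Q => h.
have := ratio_count_multiples x0 y0 A lamE; rewrite -/l.
set q := (A.-1 %/ l)%N; set r := ratio_count A lam => hr.
have hQA : (Q <= A + 2 * A * r)%N.
  have [Al|lA'] := leqP A l.
    apply: leq_trans (leq_addr _ _); apply: leq_trans (leq_div2l _ A0 Al) _.
    by rewrite /B -mulnn mulnK.
  have q1 : (1 <= q)%N by rewrite divn_gt0 //; lia.
  have qE : (A.-1 < q.+1 * l)%N by apply: ltn_ceil.
  have ql : (l <= q * l)%N by rewrite leq_pmull.
  have Aq : (A <= 2 * (q * l))%N by rewrite mulSn in qE; lia.
  rewrite -(leq_pmul2r l0); apply: (leq_trans hQ).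
  apply: (@leq_trans (2 * A * q * l)).
    by rewrite /B -mulnn -(mulnC A) -mulnA -!mulnA leq_mul2l mulnA -mulnA Aq orbT.
  rewrite leq_mul2r; apply/orP; right; apply: leq_trans (leq_addl _ _).
  by rewrite leq_mul2l hr orbT.
apply: (@leq_trans (p * (K.+1 * Q.+1))); first by rewrite leq_mul2l h orbT.
have hp : (p * Q.+1 <= p * A + p * (A + 2 * A * r))%N.
  by rewrite mulnS leq_add ?leq_pmulr // leq_mul2l hQA orbT.
by rewrite mulSn mulnDr; lia.
Qed.

(** * Multiplicative energy of an interval and a set *)

Lemma cauchy_schwarz_sum (R : realDomainType) (I : finType) (P : pred I)
    (f g : I -> R) :
  (\sum_(i | P i) f i * g i) ^+ 2
    <= (\sum_(i | P i) f i ^+ 2) * (\sum_(i | P i) g i ^+ 2).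
Proof.
rewrite -subr_ge0 -(pmulrn_lge0 _ (isT : (0 < 2)%N)).
have -> : ((\sum_(i | P i) f i ^+ 2) * (\sum_(i | P i) g i ^+ 2)
    - (\sum_(i | P i) f i * g i) ^+ 2) *+ 2 =
    \sum_(i | P i) \sum_(j | P j) (f i * g j - f j * g i) ^+ 2.
  transitivity (\sum_(i | P i) \sum_(j | P j)
      (f i ^+ 2 * g j ^+ 2 + g i ^+ 2 * f j ^+ 2
       - (f i * g i) * (f j * g j) *+ 2)); last first.
    by apply: eq_bigr => i _; apply: eq_bigr => j _; ring.
  under [RHS]eq_bigr do rewrite sumrB big_split /= sumrMnl -!mulr_sumr.
  rewrite sumrB big_split /= sumrMnl -!mulr_suml; ring.
by apply: sumr_ge0 => i _; apply: sumr_ge0 => j _; apply: sqr_ge0.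
Qed.

Lemma leq_sqr_sum (I : finType) (M : {set I}) (f : I -> nat) :
  ((\sum_(i in M) f i) ^ 2 <= #|M| * \sum_(i in M) f i ^ 2)%N.
Proof.
have /= := cauchy_schwarz_sum (mem M) (fun=> 1 : int) (fun i => (f i)%:R).
under eq_bigr => i _ do rewrite mul1r.
under [X in _ <= X * _]eq_bigr do rewrite expr1n.
under [X in _ <= _ * X]eq_bigr do rewrite -natrX.
by rewrite -!natr_sum -natrX sumr_const -natrM ler_nat.
Qed.

Lemma card_pair_dep (X Y : finType) (W : {set X}) (Q : X -> {set Y}) :
  (\sum_(w in W) #|Q w| = #|[set t : X * Y | (t.1 \in W) && (t.2 \in Q t.1)]|)%N.
Proof.
rewrite cardsE -sum1_card -(pair_big_dep (mem W) (fun w y => y \in Q w) (fun _ _ => 1%N)).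
by apply: eq_bigr => w _; rewrite sum1_card.
Qed.

Lemma card_ord_divisors (A u : nat) : (0 < u)%N ->
  (#|[set d : 'I_A | (d %| u)%N]| <= size (divisors u))%N.
Proof.
move=> u0; rewrite cardE -(size_map val); apply: uniq_leq_size.
  by rewrite map_inj_uniq ?enum_uniq //; apply: val_inj.
by move=> _ /mapP[d + ->]; rewrite mem_enum inE -dvdn_divisors.
Qed.

(** The multiplicative energy of the interval [1 <= a < A] and [M], that is, the
    number of solutions of [a m' = a' m], sorted by the pair [(m, m')]. *)
Definition energy (p A : nat) (M : {set 'F_p}) : nat :=
  (\sum_(m in M) \sum_(m' in M) ratio_count A (m' / m))%N.

(** Two steps [m1 a1 = a1' m] and [m2 a2 = a2' m] through a common [m] compose
    to [m1 (a1 a2') = m2 (a2 a1')]; both products are below [A ^ 2], and they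
    determine the path up to the choice of the divisors [a1] and [a2]. *)
Lemma path_count_leq (p A tau : nat) (M : {set 'F_p}) (m1 m2 : 'F_p) :
  prime p -> (A <= p)%N -> m2 != 0 -> 0 \notin M ->
  (forall u, 0 < u < A ^ 2 -> size (divisors u) <= tau)%N ->
  (\sum_(m in M) ratio_count A (m1 / m) * ratio_count A (m2 / m)
     <= tau ^ 2 * ratio_count (A ^ 2) (m1 / m2))%N.
Proof.
move=> pP Ap m2N0 M0 htau.
have ltA (i j : 'I_A) : (i * j < A ^ 2)%N by rewrite -mulnn ltn_mul.
have ordN0 (i : 'I_A) : (0 < i)%N -> (i : nat)%:R != 0 :> 'F_p.
  move=> i0; rewrite natr_Fp_eq0 //; apply/negP => /dvdn_leq.
  by have := ltn_ord i; lia.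
pose P B lam := [set z : 'I_B * 'I_B |
  [&& (0 < z.1)%N, (0 < z.2)%N & lam * (z.1)%:R == (z.2)%:R :> 'F_p]].
pose W := P (A ^ 2)%N (m1 / m2).
pose D (w : 'I_(A ^ 2) * 'I_(A ^ 2)) :=
  setX [set d : 'I_A | (d %| w.1)%N] [set d : 'I_A | (d %| w.2)%N].
apply: (@leq_trans (\sum_(w in W) #|D w|)); last first.
  rewrite mulnC -sum_nat_const; apply: leq_sum => -[u v].
  rewrite inE => /and3P[/= u0 v0 _]; rewrite cardsX -(mulnn tau).
  by apply: leq_mul; apply: leq_trans (card_ord_divisors _ _) (htau _ _);
    rewrite ?u0 ?v0 ?ltn_ord.
under eq_bigr do rewrite /ratio_count -cardsX.
rewrite !card_pair_dep.
set S := [set t | _]; set S' := [set t | _].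
pose f (t : 'F_p * (('I_A * 'I_A) * ('I_A * 'I_A))) :=
  ((Ordinal (ltA t.2.1.1 t.2.2.2), Ordinal (ltA t.2.2.1 t.2.1.2)),
   (t.2.1.1, t.2.2.1)).
have step (m n : 'F_p) (i j : 'I_A) : m \in M -> n / m * i%:R = j%:R ->
    n * i%:R = j%:R * m.
  move=> mM <-; rewrite mulrAC divfK //.
  by apply: contraNneq M0 => <-.
have fI : {in S &, injective f}.
  move=> [m [[a b] [c d]]] [m' [[a' b'] [c' d']]].
  rewrite !inE /= => /andP[mM /andP[/and3P[a0 b0 /eqP Eab] /and3P[c0 d0 /eqP Ecd]]].
  move=> /andP[m'M /andP[/and3P[a'0 b'0 /eqP Eab'] /and3P[c'0 d'0 /eqP Ecd']]].
  case=> Ead Ecb Ea Ec; subst a' c'.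
  have Eb : b = b' by apply: val_inj; apply/eqP; rewrite -(eqn_pmul2l c0) Ecb.
  have Ed : d = d' by apply: val_inj; apply/eqP; rewrite -(eqn_pmul2l a0) Ead.
  subst b' d'; congr (_, _).
  apply: (mulfI (ordN0 b b0)).
  by rewrite -(step _ _ _ _ mM Eab) -(step _ _ _ _ m'M Eab').
rewrite -(card_in_imset fI); apply: subset_leq_card.
apply/subsetP => _ /imsetP[[m [[a b] [c d]]] + ->].
rewrite !inE /= => /andP[mM /andP[/and3P[a0 b0 /eqP Eab] /and3P[c0 d0 /eqP Ecd]]].
rewrite !muln_gt0 a0 d0 c0 b0 !dvdn_mulr //= andbT.
move: (step _ _ _ _ mM Eab) (step _ _ _ _ mM Ecd) => {}Eab {}Ecd.
rewrite !natrM -(inj_eq (mulIf m2N0)) mulrAC divfK //.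
by rewrite mulrA Eab -mulrA (mulrC m) -Ecd mulrCA mulrC (mulrC b%:R).
Qed.

(** Cauchy-Schwarz over the middle vertex of the paths of length two, followed
    by the box bound [ratio_count_sqr].  The terms [ratio_count A (m1 / m2)]
    that it produces sum up to the energy again, so the bound is recursive. *)
Lemma energy_sqr_leq (p A tau : nat) (M : {set 'F_p}) :
  prime p -> (0 < A)%N -> (A ^ 2 <= p)%N -> 0 \notin M ->
  (forall u, 0 < u < A ^ 2 -> size (divisors u) <= tau)%N ->
  (p * energy A M ^ 2 <= #|M| * tau ^ 2 *
     (#|M| ^ 2 * (2 * A ^ 4 + 5 * (p * A)) + 2 * (p * A) * energy A M))%N.
Proof.
move=> pP A0 Ap M0 htau.
have MN0 m : m \in M -> m != 0 by move=> mM; apply: contraNneq M0 => <-.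
have leAp : (A <= p)%N by apply: leq_trans Ap; rewrite -mulnn leq_pmulr.
have paths : (energy A M ^ 2 <= #|M| * (tau ^ 2 *
    \sum_(m2 in M) \sum_(m1 in M) ratio_count (A ^ 2) (m1 / m2)))%N.
  apply: leq_trans (leq_sqr_sum _ _) _; rewrite leq_mul2l; apply/orP; right.
  under eq_bigr => m _ do rewrite -mulnn big_distrl /=.
  under eq_bigr => m _ do under eq_bigr => m1 _ do rewrite big_distrr /=.
  rewrite exchange_big /=.
  under eq_bigr => m1 _ do rewrite exchange_big /=.
  rewrite exchange_big /= big_distrr /=; apply: leq_sum => m2 m2M.
  rewrite big_distrr /=; apply: leq_sum => m1 m1M.
  by apply: path_count_leq => //; apply: MN0.
apply: (@leq_trans (#|M| * (tau ^ 2 * \sum_(m2 in M) \sum_(m1 in M)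
    p * ratio_count (A ^ 2) (m1 / m2)))).
  rewrite mulnC; apply: leq_trans (leq_mul paths (leqnn p)) _.
  under [X in (_ <= _ * (_ * X))%N]eq_bigr do rewrite -big_distrr /=.
  by rewrite -big_distrr /=; apply: eq_leq; ring.
rewrite mulnA leq_mul2l; apply/orP; right.
apply: (@leq_trans (\sum_(m2 in M) \sum_(m1 in M) ((2 * A ^ 4 + 5 * (p * A))
    + 2 * (p * A) * ratio_count A (m1 / m2)))).
  apply: leq_sum => m2 m2M; apply: leq_sum => m1 m1M.
  by apply: ratio_count_sqr; rewrite ?mulf_neq0 ?invr_neq0 ?MN0.
under eq_bigr do rewrite big_split /= sum_nat_const -big_distrr /=.
rewrite big_split /= sum_nat_const -big_distrr /= mulnA mulnn leq_add2l.
exact: leqnn.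
Qed.

(** * A trigonometric minorant of an arc *)

Lemma normr_sin_mulrn (R : realType) (x : R) (n : nat) :
  `|sin (x *+ n)| <= n%:R * `|sin x|.
Proof.
elim: n => [|n IHn]; first by rewrite mulr0n sin0 normr0 mul0r.
rewrite mulrS sinD; apply: le_trans (ler_normD _ _) _; rewrite !normrM.
rewrite -natr1 mulrDl mul1r addrC; apply: lerD.
  by apply: le_trans IHn; rewrite ler_piMl // cos_max.
by rewrite ler_piMr // cos_max.
Qed.

(** [|sin (N y)| <= N |sin y|] at [y = pi / (2 N)], where the left side is 1. *)
Lemma one_sub_cos_ge (R : realType) (N : nat) : (0 < N)%N ->
  2%:R / N%:R ^+ 2 <= 1 - cos (pi / N%:R) :> R.
Proof.
move=> N0; have N0R : 0 < N%:R :> R by rewrite ltr0n.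
pose y : R := pi / (2%:R * N%:R).
have -> : pi / N%:R = y *+ 2.
  by rewrite /y -mulr_natl; field; rewrite lt0r_neq0.
have hy : y *+ N = pi / 2%:R.
  by rewrite /y -mulr_natl; field; rewrite lt0r_neq0.
have := normr_sin_mulrn y N; rewrite hy sin_pihalf normr1 => h.
rewrite cos_mulr2n cos2sin2 ler_pdivrMr ?exprn_gt0 //.
have : 1 <= (N%:R * `|sin y|) ^+ 2 by rewrite exprn_ege1.
rewrite exprMn real_normK ?num_real // => h2.
rewrite (_ : _ * _ = 2%:R * (N%:R ^+ 2 * sin y ^+ 2)); last by ring.
by rewrite ler_pMr.
Qed.

Lemma cos_le_outside (R : realType) (a x : R) : 0 <= a -> a <= x ->
  x <= pi *+ 2 - a -> cos x <= cos a.
Proof.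
have decr u v : 0 <= u -> u <= v -> v <= pi -> cos v <= cos u :> R.
  move=> u0; rewrite le_eqVlt => /predU1P[->//|uv] vpi.
  by apply: ltW; rewrite ltr_cos // in_itv /= ?u0 ?(ltW (lt_le_trans uv _)) // vpi
    (le_trans u0 (ltW uv)).
move=> a0 ax xa; have [xpi|pix] := leP x pi; first exact: decr.
rewrite -[x]opprK cosN -cosD2pi; apply: decr => //; last by lra.
by rewrite -[leLHS](opprK); lra.
Qed.

Lemma sum_cosB (R : realType) (I J : finType) (a : I -> R) (b : J -> R) :
  \sum_i \sum_j cos (a i - b j) =
  (\sum_i cos (a i)) * (\sum_j cos (b j)) + (\sum_i sin (a i)) * (\sum_j sin (b j)).
Proof.
rewrite !mulr_suml -big_split; apply: eq_bigr => i _.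
by rewrite !mulr_sumr -big_split; apply: eq_bigr => j _; rewrite cosB.
Qed.

Lemma cos_distn (R : realType) (u v : nat) (t : R) :
  cos (t *+ `|u%:Z - v%:Z|) = cos (t *+ u - t *+ v).
Proof.
have [uv|/ltnW vu] := leqP u v.
  by rewrite distnC distnEl // mulrnBr // -opprB cosN.
by rewrite distnEl // mulrnBr.
Qed.

Section FejerMinorant.

Variables (R : realType) (n : nat).

(** Only cosines occur below, so frequencies are counted up to sign. *)
Definition dist_count (T : finType) (f g : T -> nat) (b : nat) : nat :=
  #|[set z : 'I_n * T | `|(z.1 + f z.2)%N%:Z - (g z.2)%:Z|%N == b]|.

Lemma dist_count_leq (T : finType) (f g : T -> nat) (b : nat) :
  (dist_count f g b <= 2 * #|T|)%N.
Proof.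
pose h (z : 'I_n * T) := ((z.1 + f z.2 <= g z.2)%N, z.2).
have hI : {in [set z : 'I_n * T | `|(z.1 + f z.2)%N%:Z - (g z.2)%:Z|%N == b] &,
    injective h}.
  move=> [i w] [i' w']; rewrite !inE /= => /eqP E /eqP E' [e ew]; subst w'.
  by congr (_, _); apply: val_inj => /=; lia.
by rewrite /dist_count -(card_in_imset hI) -card_bool -card_prod max_card.
Qed.

Lemma sum_dist_count (T : finType) (f g : T -> nat) (B : nat) (t : R) :
  (forall (i : 'I_n) w, `|(i + f w)%N%:Z - (g w)%:Z|%N < B)%N ->
  \sum_(b < B) (dist_count f g b)%:R * cos (t *+ b) =
  \sum_(i < n) \sum_w cos (t *+ (i + f w) - t *+ g w).
Proof.
move=> ltB; rewrite pair_bigA /=.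
rewrite (partition_big (fun z => Ordinal (ltB z.1 z.2)) xpredT) //=.
apply: eq_bigr => b _; rewrite /dist_count -sum1_card natr_sum mulr_suml.
apply: eq_big => [z|z]; rewrite inE ?mul1r //.
by move=> /eqP <-; rewrite cos_distn.
Qed.

Let U t : R := \sum_(i < n) cos (t *+ i).
Let V t : R := \sum_(i < n) sin (t *+ i).
(** The Fejer kernel |1 + e(t) + ... + e((n-1) t)|^2. *)
Let D t : R := U t ^+ 2 + V t ^+ 2.

(** Summing the geometric progression, |e(t) - 1|^2 D(t) = |e(n t) - 1|^2 with
    e(t) = exp(i t); here this is done on real and imaginary parts. *)
Lemma fejer_closed_form t : (1 - cos t) * D t = 1 - cos (t *+ n).
Proof.
have [EU EV] : cos t * U t - sin t * V t - U t = cos (t *+ n) - 1 /\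
    sin t * U t + cos t * V t - V t = sin (t *+ n).
  rewrite /U /V; elim: n => [|m [IHU IHV]].
    by rewrite !big_ord0 !mulr0 subrr addr0 subr0 mulr0n cos0 sin0 subrr.
  rewrite !big_ord_recr /= mulrS cosD sinD -IHV.
  by rewrite -[cos (t *+ m)](subrK 1) -IHU; split; ring.
have ct := sin2cos2 t; have cn := sin2cos2 (t *+ n).
have E : (cos (t *+ n) - 1) ^+ 2 + sin (t *+ n) ^+ 2 = (2%:R - cos t *+ 2) * D t.
  by rewrite -EU -EV /D; ring: ct.
have : 2%:R * ((1 - cos t) * D t) = 2%:R * (1 - cos (t *+ n)).
  rewrite mulrA -[2%:R * (1 - cos t)](_ : 2%:R - cos t *+ 2 = _); last by ring.
  by rewrite -E; ring: cn.
by apply: mulfI; rewrite pnatr_eq0.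
Qed.

Let quad := ('I_n * ('I_n * 'I_n))%type.
Let count4 := dist_count (fun w : quad => w.1) (fun w : quad => w.2.1 + w.2.2)%N.
Let count2 := dist_count (fun=> 0%N) (fun j : 'I_n => j).
Let count2s := dist_count (fun=> n) (fun j : 'I_n => j).

Lemma sum_count4 t :
  \sum_(b < n.*2) (count4 b)%:R * cos (t *+ b) = D t ^+ 2.
Proof.
rewrite sum_dist_count => [|i [k [j l]] /=]; last by move: (ltn_ord i) (ltn_ord k) (ltn_ord j) (ltn_ord l); lia.
pose a (q : 'I_n * 'I_n) : R := t *+ (q.1 + q.2).
have -> : \sum_(i < n) \sum_(w : quad) cos (t *+ (i + w.1) - t *+ (w.2.1 + w.2.2))
    = \sum_p \sum_q cos (a p - a q).
  rewrite -(pair_bigA _ (fun i k => \sum_q cos (a (i, k) - a q))) /=.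
  by apply: eq_bigr => i _; rewrite -(pair_bigA _ (fun k q => cos (a (i, k) - a q))).
rewrite sum_cosB.
have -> : \sum_q cos (a q) = U t ^+ 2 - V t ^+ 2.
  rewrite -(pair_bigA _ (fun i k => cos (a (i, k)))) /= !expr2 /U /V.
  rewrite !mulr_suml -sumrB; apply: eq_bigr => i _.
  by rewrite !mulr_sumr -sumrB; apply: eq_bigr => k _; rewrite /a mulrnDr cosD.
have -> : \sum_q sin (a q) = 2%:R * (U t * V t).
  rewrite mulr_natl mulr2n {1}[U t * V t]mulrC.
  rewrite -(pair_bigA _ (fun i k => sin (a (i, k)))) /= /U /V.
  rewrite !mulr_suml -big_split; apply: eq_bigr => i _.
  by rewrite !mulr_sumr -big_split; apply: eq_bigr => k _; rewrite /a mulrnDr sinD.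
by rewrite /D; ring.
Qed.

Lemma sum_count2 t : \sum_(b < n.*2) (count2 b)%:R * cos (t *+ b) = D t.
Proof.
rewrite sum_dist_count => [|i j]; last by move: (ltn_ord i) (ltn_ord j); lia.
by under eq_bigr do rewrite addn0; rewrite sum_cosB /D !expr2.
Qed.

Lemma sum_count2s t :
  \sum_(b < n.*2) (count2s b)%:R * cos (t *+ b) = cos (t *+ n) * D t.
Proof.
rewrite sum_dist_count => [|i j]; last by move: (ltn_ord i) (ltn_ord j); lia.
rewrite (sum_cosB (fun i : 'I_n => t *+ (i + n)) (fun j : 'I_n => t *+ j)).
have -> : \sum_(i < n) cos (t *+ (i + n)) = U t * cos (t *+ n) - V t * sin (t *+ n).
  by rewrite /U /V !mulr_suml -sumrB; apply: eq_bigr => i _; rewrite mulrnDr cosD.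
have -> : \sum_(i < n) sin (t *+ (i + n)) = V t * cos (t *+ n) + U t * sin (t *+ n).
  by rewrite /U /V !mulr_suml -big_split; apply: eq_bigr => i _; rewrite mulrnDr sinD.
by rewrite -/(U t) -/(V t) /D; ring.
Qed.

(** Cauchy-Schwarz for the 2 n possible values of a sum of two elements. *)
Lemma count4_0_ge : (n ^ 3 <= 2 * count4 0)%N.
Proof.
have [->|n0] := posnP n; first by [].
have ltS (q : 'I_n * 'I_n) : (q.1 + q.2 < n.*2)%N.
  by move: (ltn_ord q.1) (ltn_ord q.2); lia.
pose r (b : 'I_(n.*2)) := [set q : 'I_n * 'I_n | (q.1 + q.2 == b)%N].
have sumr : (\sum_b #|r b| = n ^ 2)%N.
  rewrite -mulnn -[in RHS](card_ord n) -card_prod -sum1_card.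
  rewrite (partition_big (fun q => Ordinal (ltS q)) xpredT) //=.
  by apply: eq_bigr => b _; rewrite sum1_card cardsE.
have := leq_sqr_sum [set: 'I_(n.*2)] (fun b => #|r b|).
rewrite cardsT card_ord.
under eq_bigl do rewrite inE.
under [X in (_ <= _ * X)%N]eq_bigl do rewrite inE.
rewrite sumr => h.
have h4 : (\sum_b #|r b| ^ 2 <= count4 0)%N.
  under eq_bigr do rewrite -mulnn -cardsX.
  rewrite (eq_bigl (fun b => b \in [set: 'I_(n.*2)])) => [|b]; last by rewrite inE.
  rewrite card_pair_dep.
  set S := [set t | _].
  pose f (t : 'I_(n.*2) * (('I_n * 'I_n) * ('I_n * 'I_n))) : 'I_n * quad :=
    (t.2.1.1, (t.2.1.2, t.2.2)).
  have fI : {in S &, injective f}.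
    move=> [b [[i k] q]] [b' [[i' k'] q']]; rewrite !inE /=.
    move=> /andP[/eqP E _] /andP[/eqP E' _] [ei ek eq]; subst.
    by congr (_, _); apply: val_inj; rewrite /= -E -E'.
  rewrite -(card_in_imset fI); apply: subset_leq_card.
  apply/subsetP => _ /imsetP[[b [[i k] [j l]]] + ->]; rewrite !inE /=.
  by move=> /andP[/eqP E /eqP E']; rewrite E E' subrr.
have : (n ^ 2 * n ^ 2 <= (2 * count4 0 * n) )%N.
  rewrite mulnn; apply: leq_trans h _; apply: leq_trans (leq_mul (leqnn _) h4) _.
  by rewrite -mul2n mulnAC.
by rewrite -expnD -[(2 + 2)%N]/(3 + 1)%N expnD expn1 leq_pmul2r.
Qed.

(** The polynomial [(cos t - (1 - beta)) D(t)^2], which is nonpositive off the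
    arc [cos t > 1 - beta], equals [beta D^2 - (1 - cos (n t)) D] by the closed
    form of the kernel.  Its constant term is of order [beta n^3] because [D^2]
    has about [n^3] solutions at frequency 0, while no frequency is hit more
    than [O(n^3)] times by [D^2] and [O(n)] times by the other two terms. *)
Lemma fejer_minorant (beta : R) : 8%:R <= beta * n%:R ^+ 2 ->
  exists c : nat -> R, [/\ 1 <= c 0%N, forall b, `|c b| <= 9%:R &
    forall t, cos t <= 1 - beta -> \sum_(b < n.*2) c b * cos (t *+ b) <= 0].
Proof.
move=> hbeta.
have n0 : (0 < n)%N.
  by rewrite lt0n; apply: contraTneq hbeta => ->; rewrite expr0n mulr0 lern0.
have n0R : 0 < n%:R :> R by rewrite ltr0n.
have beta0 : 0 < beta.
  by rewrite -(pmulr_lgt0 _ (exprn_gt0 2 n0R)); apply: lt_le_trans hbeta.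
(* A lower bound for the constant term, used to normalize it. *)
pose K := beta * n%:R ^+ 3 / 4%:R.
have K0 : 0 < K by rewrite !mulr_gt0 ?exprn_gt0 // invr_gt0.
have nK : 2%:R * n%:R <= K.
  rewrite /K (_ : _ / _ = beta * n%:R ^+ 2 * (n%:R / 4%:R)); last by ring.
  rewrite (_ : 2%:R * _ = 8%:R * (n%:R / 4%:R)); last by field.
  by rewrite ler_wpM2r // divr_ge0.
have c4_le b : (count4 b)%:R <= 2%:R * n%:R ^+ 3 :> R.
  rewrite -natrX -natrM ler_nat (leq_trans (dist_count_leq _ _ _)) //.
  by rewrite !card_prod !card_ord !expnS expn0 muln1.
have c4_ge : n%:R ^+ 3 <= 2%:R * (count4 0)%:R :> R.
  by rewrite -natrX -natrM ler_nat count4_0_ge.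
have c2_le b : (count2 b)%:R <= 2%:R * n%:R :> R.
  by rewrite -natrM ler_nat (leq_trans (dist_count_leq _ _ _)) // card_ord.
have c2s_le b : (count2s b)%:R <= 2%:R * n%:R :> R.
  by rewrite -natrM ler_nat (leq_trans (dist_count_leq _ _ _)) // card_ord.
pose g b : R := beta * (count4 b)%:R - (count2 b)%:R + (count2s b)%:R.
have c2_ge b : 0 <= (count2 b)%:R :> R by [].
have c2s_ge b : 0 <= (count2s b)%:R :> R by [].
exists (fun b => g b / K); split=> [|b|t ct].
- rewrite ler_pdivlMr // mul1r /g.
  have : beta * n%:R ^+ 3 <= beta * (2%:R * (count4 0)%:R) by rewrite ler_pM2l.
  by have := c2_le 0%N; have := c2s_ge 0%N; rewrite /K in nK *; lra.
- rewrite normrM normfV (gtr0_norm K0) ler_pdivrMr // ler_norml /g.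
  have h0 : 0 <= beta * (count4 b)%:R by rewrite mulr_ge0 // ltW.
  have h1 : beta * (count4 b)%:R <= beta * (2%:R * n%:R ^+ 3) by rewrite ler_pM2l.
  have := c2_le b; have := c2s_le b; have := c2_ge b; have := c2s_ge b.
  by rewrite /K in nK *; move=> *; apply/andP; split; lra.
have -> : \sum_(b < n.*2) g b / K * cos (t *+ b) =
    (beta * D t ^+ 2 - D t + cos (t *+ n) * D t) / K.
  rewrite -sum_count4 -sum_count2s -{1}sum_count2 mulr_sumr -sumrB -big_split.
  by rewrite mulr_suml; apply: eq_bigr => b _; rewrite /g /=; ring.
rewrite (_ : _ - _ + _ = beta * D t ^+ 2 - (1 - cos (t *+ n)) * D t); last by ring.
rewrite -fejer_closed_form -mulrA -expr2 -mulrBl.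
rewrite pmulr_lle0 ?invr_gt0 // mulr_le0_ge0 ?sqr_ge0 //.
by lra.
Qed.

End FejerMinorant.

(** * Fourier analysis modulo p *)

Section FourierFp.

Variables (R : realType) (p : nat).
Hypothesis pP : prime p.

Let omega : R := pi *+ 2 / p%:R.

(** The real and imaginary parts of the standard additive character. *)
Let chi (y : 'F_p) : R := cos (omega *+ y).
Let sgm (y : 'F_p) : R := sin (omega *+ y).

Lemma omega_mod n : omega *+ n = omega *+ (n %% p) + (pi *+ 2) *+ (n %/ p).
Proof.
rewrite {1}(divn_eq n p) addnC mulrnDr; congr (_ + _).
rewrite mulnC mulrnA; congr (_ *+ _).
by rewrite /omega -[LHS]mulr_natr divfK // pnatr_eq0 -lt0n (prime_gt0 pP).
Qed.

Lemma cos_omega n : cos (omega *+ n) = chi n%:R.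
Proof. by rewrite /chi val_Fp_nat // omega_mod (periodicn (@cosD2pi R)). Qed.

Lemma sin_omega n : sin (omega *+ n) = sgm n%:R.
Proof. by rewrite /sgm val_Fp_nat // omega_mod (periodicn (@sinD2pi R)). Qed.

Lemma chiD y z : chi (y + z) = chi y * chi z - sgm y * sgm z.
Proof.
by rewrite -[in LHS](natr_Zp y) -[in LHS](natr_Zp z) -natrD -cos_omega mulrnDr cosD.
Qed.

Lemma sgmD y z : sgm (y + z) = sgm y * chi z + chi y * sgm z.
Proof.
by rewrite -[in LHS](natr_Zp y) -[in LHS](natr_Zp z) -natrD -sin_omega mulrnDr sinD.
Qed.

Lemma chi0 : chi 0 = 1.
Proof. by rewrite /chi mulr0n cos0. Qed.

Lemma chiB y z : chi (y - z) = chi y * chi z + sgm y * sgm z.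
Proof.
have := chiD (y - z) z; have := sgmD (y - z) z; rewrite subrK => -> ->.
have := cos2Dsin2 (omega *+ z); rewrite -/(chi z) -/(sgm z) => E.
by rewrite -[LHS]mulr1 -E; ring.
Qed.

Lemma chi_neq1 z : z != 0 -> chi z != 1.
Proof.
move=> z0; have zp : (z < p)%N by rewrite -[X in (_ < X)%N](Fp_cast pP).
have z1 : (0 < z)%N by rewrite lt0n; apply: contraNneq z0 => E; apply/eqP/val_inj.
have p0 : 0 < p%:R :> R by rewrite ltr0n prime_gt0.
pose x : R := pi * z%:R / p%:R.
have -> : chi z = cos (x *+ 2).
  by congr cos; rewrite /x /omega -mulr_natr -[RHS]mulr_natr; ring.
have : 0 < sin x.
  have z1R : 0 < z%:R :> R by rewrite ltr0n.
  apply: sin_gt0_pi; rewrite divr_gt0 ?mulr_gt0 ?pi_gt0 //=.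
  by rewrite ltr_pdivrMr // ltr_pM2l ?pi_gt0 // ltr_nat.
move=> sx; have s2 : 0 < sin x ^+ 2 by rewrite exprn_gt0.
by rewrite cos_mulr2n cos2sin2; apply/eqP; lra.
Qed.

(** Shifting the summation variable by 1 and by -1 shows that the sum S
    satisfies 2 S = 2 chi(z) S. *)
Lemma sum_chi z : \sum_(t : 'F_p) chi (t * z) = (z == 0)%:R * p%:R.
Proof.
have [->|z0] := eqVneq z 0.
  rewrite mul1r; under eq_bigr do rewrite mulr0 chi0.
  by rewrite sumr_const card_Fp.
rewrite mul0r; set S := \sum_t _.
have ES1 : S = \sum_(t : 'F_p) chi (t * z + z).
  rewrite /S (reindex_inj (addIr (1 : 'F_p))) /=.
  by apply: eq_bigr => t _; rewrite mulrDl mul1r.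
have ES2 : S = \sum_(t : 'F_p) chi (t * z - z).
  rewrite /S (reindex_inj (addIr (- 1 : 'F_p))) /=.
  by apply: eq_bigr => t _; rewrite mulrBl mul1r.
have E : S + S = 2%:R * chi z * S.
  rewrite {1}ES1 {1}ES2 -big_split mulr_sumr; apply: eq_bigr => t _.
  by rewrite /= chiD chiB; ring.
have : (1 - chi z) * S = 0 by lra.
move/eqP; rewrite mulf_eq0 subr_eq0 eq_sym (negPf (chi_neq1 z0)) /=.
by move/eqP.
Qed.

Let C (X : {set 'F_p}) (t : 'F_p) : R := \sum_(x in X) chi (t * x).
Let S (X : {set 'F_p}) (t : 'F_p) : R := \sum_(x in X) sgm (t * x).

Lemma parseval (X : {set 'F_p}) :
  \sum_t C X t ^+ 2 + \sum_t S X t ^+ 2 = p%:R * #|X|%:R.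
Proof.
rewrite -big_split /=.
transitivity (\sum_t \sum_(x in X) \sum_(x' in X) chi (t * (x - x'))).
  apply: eq_bigr => t _; rewrite /C /S !expr2 !mulr_suml -big_split.
  apply: eq_bigr => x _; rewrite /= !mulr_sumr -big_split.
  by apply: eq_bigr => x' _; rewrite mulrBr chiB.
rewrite exchange_big /=.
under eq_bigr do rewrite exchange_big /=.
under eq_bigr do under eq_bigr do rewrite sum_chi subr_eq0.
transitivity (\sum_(x in X) (p%:R : R)); last by rewrite sumr_const mulr_natr.
apply: eq_bigr => x xX; rewrite (bigD1 x) //= eqxx mul1r big1 ?addr0 //.
by move=> x' /andP[_]; rewrite eq_sym => /negPf ->; rewrite mul0r.
Qed.

(** Group the pairs [z = (b, m)] by [t = b / m]: Cauchy-Schwarz over [t] leaves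
    the second moment of the size of a group, which is the energy. *)
Lemma weighted_sum_sqr (A : nat) (M : {set 'F_p}) (u : nat -> R) (B : R)
    (F : 'F_p -> R) : 0 \notin M -> 0 <= B -> (forall b, `|u b| <= B) ->
  (\sum_(z : 'I_A * 'F_p | (0 < z.1)%N && (z.2 \in M))
     u z.1 * F ((z.1)%:R / z.2)) ^+ 2
    <= B ^+ 2 * (energy A M)%:R * \sum_t F t ^+ 2.
Proof.
move=> M0 B0 uB.
pose G (t : 'F_p) := [set z : 'I_A * 'F_p |
  [&& (0 < z.1)%N, z.2 \in M & (z.1)%:R / z.2 == t]].
have GE : (\sum_t #|G t| ^ 2 <= energy A M)%N.
  rewrite /energy.
  under eq_bigr do rewrite -mulnn -cardsX.
  rewrite [leqLHS](eq_bigl (fun t => t \in [set: 'F_p])) => [|t]; last by rewrite inE.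
  under [leqRHS]eq_bigr do rewrite card_pair_dep.
  rewrite !card_pair_dep.
  set T := [set t | _]; set T' := [set t | _].
  pose f (t : 'F_p * (('I_A * 'F_p) * ('I_A * 'F_p))) :=
    (t.2.1.2, (t.2.2.2, (t.2.1.1, t.2.2.1))).
  have fI : {in T &, injective f}.
    move=> [t [[b m] [b' m']]] [t1 [[b1 m1] [b1' m1']]]; rewrite !inE /=.
    move=> /andP[/and3P[_ _ /eqP <-] _] /andP[/and3P[_ _ /eqP <-] _].
    by case=> -> -> -> ->.
  rewrite -(card_in_imset fI); apply: subset_leq_card.
  apply/subsetP => _ /imsetP[[t [[b m] [b' m']]] + ->]; rewrite !inE /=.
  move=> /andP[/and3P[b0 mM /eqP Et] /and3P[b'0 m'M /eqP Et']].
  rewrite mM m'M b0 b'0 /= mulrAC -mulrA Et -Et' mulrC divfK //.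
  by apply: contraNneq M0 => <-.
rewrite (partition_big (fun z : 'I_A * 'F_p => (z.1)%:R / z.2) xpredT) //=.
have -> : \sum_t \sum_(z : 'I_A * 'F_p | (0 < z.1)%N && (z.2 \in M) &&
      ((z.1)%:R / z.2 == t)) u z.1 * F ((z.1)%:R / z.2) =
    \sum_t (\sum_(z in G t) u z.1) * F t.
  apply: eq_bigr => t _; rewrite mulr_suml; apply: eq_big => [z|z].
    by rewrite inE andbA.
  by case/andP=> _ /eqP ->.
apply: le_trans (cauchy_schwarz_sum _ _ _) _.
apply: ler_wpM2r; first by apply: sumr_ge0 => t _; apply: sqr_ge0.
apply: (@le_trans _ _ (\sum_t B ^+ 2 * (#|G t| ^ 2)%:R)); last first.
  by rewrite -mulr_sumr -natr_sum ler_wpM2l ?sqr_ge0 // ler_nat.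
apply: ler_sum => t _; rewrite natrX -exprMn -[leLHS]real_normK ?num_real //.
rewrite ler_sqr ?nnegrE ?mulr_ge0 //.
apply: le_trans (ler_norm_sum _ _ _) _.
by rewrite mulr_natr -sumr_const ler_sum.
Qed.

(** Averaging the minorant over [x / m] gives a nonpositive number when no such
    quotient meets the interval; so the nonconstant frequencies must compensate
    the constant term, and Parseval with [weighted_sum_sqr] limits them. *)
Lemma uncovered_leq (H N : nat) (M X : {set 'F_p}) : 0 \notin M ->
  (0 < H < p)%N -> (0 < N)%N -> (p <= N * H)%N ->
  (forall x m h, x \in X -> m \in M -> (0 < h <= H)%N -> x <> h%:R * m) ->
  (#|X| * #|M| ^ 2 <= 162 * (p * energy (2 * N).*2 M))%N.
Proof.
move=> M0 /andP[H0 Hp] N0 NH uncov.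
have p0 : 0 < p%:R :> R by rewrite ltr0n prime_gt0.
have N0R : 0 < N%:R :> R by rewrite ltr0n.
pose n := (2 * N)%N; pose beta : R := 1 - cos (pi / N%:R).
have hbeta : 8%:R <= beta * n%:R ^+ 2.
  have := one_sub_cos_ge R N0; rewrite -/beta ler_pdivrMr ?exprn_gt0 // => h.
  by rewrite /n natrM exprMn; lra.
have [c [c0 cB cneg]] := fejer_minorant hbeta.
(* The angle of the midpoint (H + 1) / 2 of the interval. *)
pose phi : R := pi * H.+1%:R / p%:R.
have phiN : pi / N%:R <= phi.
  rewrite /phi -mulrA ler_pM2l ?pi_gt0 // ler_pdivlMr // mulrC ler_pdivrMr //.
  by rewrite -natrM ler_nat; lia.
have phi_pi : phi <= pi.
  by rewrite /phi -mulrA ger_pMr ?pi_gt0 // ler_pdivrMr // mul1r ler_nat.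
have piN0 : 0 <= pi / N%:R :> R by rewrite divr_ge0 ?pi_ge0.
have omegaE (k : nat) : omega *+ k = pi * (2%:R * k%:R) / p%:R.
  by rewrite /omega -mulr_natr; ring.
have off x m : x \in X -> m \in M ->
    cos (omega *+ (x / m : 'F_p) - phi) <= 1 - beta.
  move=> xX mM; rewrite /beta opprB addrCA subrr addr0.
  set y : 'F_p := x / m.
  have mN0 : m != 0 by apply: contraNneq M0 => <-.
  have yp : (y < p)%N by rewrite -[X in (_ < X)%N](Fp_cast pP).
  have [y0|y0] := posnP y.
    rewrite y0 mulr0n sub0r cosN; apply: cos_le_outside => //; lra.
  have Hy : (H < y)%N.
    rewrite ltnNge; apply/negP => yH.
    apply: (uncov x m y xX mM); first by rewrite y0.
    by rewrite natr_Zp /y divfK.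
  have yE : omega *+ y = pi * (2%:R * (y : nat)%:R) / p%:R.
    by rewrite omegaE.
  apply: cos_le_outside => //.
    apply: le_trans phiN _; rewrite lerBrDr yE -mulrDl -mulrDr.
    rewrite ler_pM2r ?invr_gt0 // ler_pM2l ?pi_gt0 // -natrM -natrD ler_nat; lia.
  apply: (@le_trans _ _ (pi *+ 2 - phi)); last by lra.
  rewrite lerD2r yE ler_pdivrMr //.
  rewrite (_ : pi *+ 2 * p%:R = pi * (2%:R * p%:R)); last by ring.
  by rewrite ler_pM2l ?pi_gt0 // -!natrM ler_nat leq_mul2l /= ltnW.
pose T1 := \sum_(z : 'I_n.*2 * 'F_p | (0 < z.1)%N && (z.2 \in M))
  (c z.1 * cos (phi *+ z.1)) * C X ((z.1)%:R / z.2).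
pose T2 := \sum_(z : 'I_n.*2 * 'F_p | (0 < z.1)%N && (z.2 \in M))
  (c z.1 * sin (phi *+ z.1)) * S X ((z.1)%:R / z.2).
have main : #|X|%:R * #|M|%:R + (T1 + T2) <= 0 :> R.
  have term (b : nat) x m : cos ((omega *+ (x / m : 'F_p) - phi) *+ b) =
      cos (phi *+ b) * chi (b%:R / m * x) + sin (phi *+ b) * sgm (b%:R / m * x).
    rewrite mulrnBl -mulrnA cosB cos_omega sin_omega natrM natr_Zp.
    rewrite [b%:R / m * x]mulrAC (mulrC b%:R) [x * b%:R / m]mulrAC.
    by congr (_ + _); apply: mulrC.
  have b0 : (0 < n.*2)%N by rewrite /n; lia.
  have -> : #|X|%:R * #|M|%:R = \sum_(m in M) \sum_(x in X) (1 : R).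
    by rewrite !sumr_const -mulrnA -natrM.
  have -> : T1 + T2 = \sum_(b < n.*2 | (0 < b)%N) \sum_(m in M) \sum_(x in X)
      c b * cos ((omega *+ (x / m : 'F_p) - phi) *+ b).
    rewrite /T1 /T2 -big_split (pair_big (fun b : 'I_n.*2 => (0 < b)%N) (mem M)
      (fun b m => \sum_(x in X) c b * cos ((omega *+ (x / m : 'F_p) - phi) *+ b))) /=.
    apply: eq_bigr => z _; rewrite /C /S !mulr_sumr -big_split.
    by apply: eq_bigr => x _; rewrite /= term; ring.
  rewrite [X in _ + X]exchange_big -big_split /=; apply: sumr_le0 => m mM.
  rewrite [X in _ + X]exchange_big -big_split /=; apply: sumr_le0 => x xX /=.
  apply: le_trans (cneg _ (off x m xX mM)).
  rewrite [leRHS](bigD1 (Ordinal b0)) //= mulr0n cos0 mulr1; apply: lerD => //.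
  by rewrite le_eqVlt (eq_bigl (fun b : 'I_n.*2 => b != Ordinal b0)) ?eqxx // => b; rewrite lt0n.
have uB1 b : `|c b * cos (phi *+ b)| <= 9%:R.
  by rewrite normrM -[leRHS]mulr1 ler_pM ?cos_max.
have uB2 b : `|c b * sin (phi *+ b)| <= 9%:R.
  by rewrite normrM -[leRHS]mulr1 ler_pM ?sin_max.
have h1 := weighted_sum_sqr n.*2 (C X) M0 (ler0n R 9) uB1.
have h2 := weighted_sum_sqr n.*2 (S X) M0 (ler0n R 9) uB2.
rewrite -/T1 in h1; rewrite -/T2 in h2.
have par := parseval X.
set E : R := (energy _ _)%:R in h1 h2.
have sq : (#|X|%:R * #|M|%:R) ^+ 2 <= 162%:R * E * (p%:R * #|X|%:R) :> R.
  rewrite -par.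
  have XM0 : 0 <= #|X|%:R * #|M|%:R :> R by rewrite mulr_ge0.
  apply: (@le_trans _ _ ((T1 + T2) ^+ 2)).
    by rewrite -[leRHS]sqrrN ler_sqr ?nnegrE; lra.
  apply: (@le_trans _ _ (2%:R * (T1 ^+ 2 + T2 ^+ 2))).
    by have := sqr_ge0 (T1 - T2); rewrite sqrrB sqrrD; lra.
  rewrite (_ : 162%:R * E * _ = 2%:R * (9%:R ^+ 2 * E * (\sum_t C X t ^+ 2)
    + 9%:R ^+ 2 * E * (\sum_t S X t ^+ 2))); last by ring.
  by rewrite ler_pM2l // lerD.
have [->|X0] := posnP #|X|; first by rewrite mul0n.
rewrite -(leq_pmul2l X0) -(ler_nat R).
rewrite -mulnn !natrM; move: sq; rewrite exprMn /E; lra.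
Qed.

End FourierFp.

(** * Putting the bounds together *)

Lemma max_divisors_bound (k : nat) : (0 < k)%N -> exists2 C : nat, (0 < C)%N &
  forall p, (0 < p)%N -> exists tau : nat,
    [/\ (0 < tau)%N, (tau ^ k <= C * p)%N &
        forall u, (0 < u <= p)%N -> (size (divisors u) <= tau)%N].
Proof.
move=> k0; have [C C0 hC] := divisor_bound k0; exists C => // p p0.
exists (\max_(u < p) size (divisors u.+1))%N.
have leM u : (0 < u <= p)%N ->
    (size (divisors u) <= \max_(u < p) size (divisors u.+1))%N.
  case: u => // u /= up.
  exact: (leq_bigmax (F := fun u : 'I_p => size (divisors u.+1)) (Ordinal up)).
split=> //; first by apply: leq_trans (leM 1%N _); rewrite ?p0.
have [|i ->] := @bigop.eq_bigmax 'I_p (fun u => size (divisors u.+1)).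
  by rewrite card_ord.
by apply: leq_trans (hC _ _) _ => //; rewrite leq_mul2l ltn_ord orbT.
Qed.

Lemma interval_prodset_mem (p H h : nat) (M : {set 'F_p}) (m : 'F_p) :
  (0 < h <= H)%N -> m \in M -> h%:R * m \in interval_prodset H M.
Proof.
move=> /andP[h0 hH] mM; apply/imset2P.
have hH' : (h < H.+1)%N by [].
by exists (Ordinal hH') m; rewrite ?inE //= mM h0.
Qed.

Lemma interval_prodset_full (p H : nat) (M : {set 'F_p}) : prime p ->
  0 \notin M -> (0 < #|M|)%N -> (p <= H)%N -> interval_prodset H M = [set: 'F_p].
Proof.
move=> pP M0 /card_gt0P[m mM] pH; apply/setP => x; rewrite inE.
have mN0 : m != 0 by apply: contraNneq M0 => <-.
have [x0|x0] := eqVneq x 0.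
  rewrite (_ : x = p%:R * m); last by rewrite x0 (pchar_Fp_0 pP) mul0r.
  by apply: interval_prodset_mem; rewrite ?prime_gt0.
rewrite (_ : x = ((x / m)%R : nat)%:R * m); last by rewrite natr_Zp divfK.
apply: interval_prodset_mem => //; apply/andP; split.
  rewrite lt0n; apply/negP => /eqP E.
  have : x / m = 0 by apply: val_inj.
  by apply/eqP; rewrite mulf_neq0 ?invr_neq0.
apply: leq_trans pH; apply: ltnW; rewrite -[X in (_ < X)%N](Fp_cast pP).
exact: ltn_ord.
Qed.

(** With [e = E / M^2], the bounds on [A] turn the bound on [E^2] into
    [e^2 <= t^2 r (8232 + 16 e)], whence [e^2 = O(t^4 r)], and [X <= 162 P e]. *)
Lemma combine_bounds (R : realType) (P M A E X t r : R) :
  0 < P -> 0 < M -> 0 <= A -> 0 <= E -> 0 <= X -> 1 <= t -> 0 <= r <= 1 ->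
  X * M ^+ 2 <= 162%:R * (P * E) ->
  P * E ^+ 2 <= M * t ^+ 2 * (M ^+ 2 * (2%:R * A ^+ 4 + 5%:R * (P * A))
                              + 2%:R * (P * A) * E) ->
  A <= 8%:R * r * M -> A ^+ 4 <= 4096%:R * r * (P * M) ->
  X ^+ 2 <= 30000%:R ^+ 2 * (t ^+ 4 * r) * P ^+ 2.
Proof.
move=> P0 M0 A0 E0 X0 t1 /andP[r0 r1] hX hE hA hA4.
pose e := E / M ^+ 2.
have M2 : 0 < M ^+ 2 by rewrite exprn_gt0.
have e0 : 0 <= e by rewrite divr_ge0 // ltW.
have EE : E = e * M ^+ 2 by rewrite /e divfK // lt0r_neq0.
have hx : X <= 162%:R * (P * e).
  by rewrite -(ler_pM2r M2); apply: le_trans hX _; rewrite EE; lra.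
have t2 : 1 <= t ^+ 2 by rewrite exprn_ege1.
have t20 : 0 <= t ^+ 2 by rewrite sqr_ge0.
have he : e ^+ 2 <= t ^+ 2 * (8232%:R * r + 16%:R * r * e).
  have PM : 0 < P * M ^+ 4 by rewrite mulr_gt0 ?exprn_gt0.
  rewrite -(ler_pM2l PM).
  rewrite (_ : P * M ^+ 4 * e ^+ 2 = P * E ^+ 2); last by rewrite EE; ring.
  apply: (le_trans hE).
  rewrite (_ : P * M ^+ 4 * _ = M * t ^+ 2 * (M ^+ 2 * (2%:R * (4096%:R * r * (P * M))
    + 5%:R * (P * (8%:R * r * M))) + 2%:R * (P * (8%:R * r * M)) * E)); last first.
    by rewrite EE; ring.
  have PA : P * A <= P * (8%:R * r * M) by rewrite ler_pM2l.
  apply: ler_wpM2l; first by rewrite mulr_ge0 // ltW.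
  apply: lerD; last by rewrite ler_wpM2r // ler_pM2l.
  by rewrite ler_pM2l //; lra.
have he2 : e ^+ 2 <= 20000%:R * (t ^+ 4 * r).
  pose w := t ^+ 2 * r.
  have w0 : 0 <= w by rewrite mulr_ge0.
  have sq : 32%:R * (w * e) <= e ^+ 2 + 256%:R * w ^+ 2.
    rewrite -subr_ge0 (_ : _ - _ = (e - 16%:R * w) ^+ 2) ?sqr_ge0 //; ring.
  have t4 : t ^+ 4 * r = t ^+ 2 * w by rewrite /w; ring.
  have h1 : w <= t ^+ 2 * w by rewrite ler_peMl.
  have h2 : w ^+ 2 <= t ^+ 2 * w.
    by rewrite expr2 ler_wpM2r // /w ler_piMr.
  have he' : e ^+ 2 <= 8232%:R * w + 16%:R * (w * e).
    by apply: (le_trans he); rewrite /w; lra.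
  by rewrite t4; lra.
apply: (@le_trans _ _ ((162%:R * (P * e)) ^+ 2)).
  by rewrite ler_sqr ?nnegrE // mulr_ge0 // mulr_ge0 // ltW.
have P2 : 0 <= P ^+ 2 by rewrite sqr_ge0.
have := ler_wpM2r P2 he2; have : 0 <= t ^+ 4 * r * P ^+ 2.
  apply: mulr_ge0 => //; apply: mulr_ge0 => //.
  by rewrite exprn_ge0 // (le_trans ler01).
by rewrite !exprMn; lra.
Qed.

Lemma powR_exprn (R : realType) (a x : R) (n : nat) :
  (a `^ x) ^+ n = a `^ (x * n%:R).
Proof. by rewrite powRrM powR_mulrn // powR_ge0. Qed.

(** Both ranges of the theorem are used through the same consequences: the first
    two bound the diagonal [A / M] and the generic [A ^ 4 / (p M)] part of the
    energy for [A] of order [p / H], the third ensures [A ^ 2 <= p]. *)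
Lemma range_consequences (R : realType) (eps P H M : R) :
  0 < eps -> 1 <= P -> 0 <= H -> 0 <= M -> M <= P ->
  [/\ H >= P `^ (2%:R / 3%:R) & H * M >= P `^ (1 + eps)]
  \/ [/\ H < P `^ (2%:R / 3%:R), M >= P `^ (1 / 3%:R)
       & H * M `^ (1 / 4%:R) >= P `^ (3%:R / 4%:R + eps)] ->
  [/\ P * P `^ eps <= H * M, P ^+ 3 * P `^ eps <= H ^+ 4 * M &
      262144%:R <= P -> 8%:R <= P `^ eps -> 64%:R * P <= H ^+ 2].
Proof.
move=> eps0 P1 H0 M0 MP.
have P0 : 0 < P by apply: lt_le_trans P1.
have Pge0 := ltW P0.
have PN0 : P != 0 by rewrite lt0r_neq0.
set q := P `^ eps.
have q1 : 1 <= q by rewrite -(powRr0 P) ler_powR // ltW.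
have q0 : 0 <= q by apply: le_trans q1.
have PqE : P `^ (1 + eps) = P * q by rewrite powRD ?PN0 ?implybT // powRr1.
case=> [[hH hHM]|[_ hM hHM]].
  rewrite PqE in hHM.
  have h3 : P ^+ 2 <= H ^+ 3.
    have -> : P ^+ 2 = (P `^ (2%:R / 3%:R)) ^+ 3.
      by rewrite powR_exprn divfK ?pnatr_eq0 // powR_mulrn.
    by rewrite ler_pXn2r ?nnegrE ?powR_ge0.
  split=> // [|P262 _].
    rewrite (_ : P ^+ 3 * q = P ^+ 2 * (P * q)); last by ring.
    rewrite (_ : H ^+ 4 * M = H ^+ 3 * (H * M)); last by ring.
    by rewrite ler_pM ?mulr_ge0 ?exprn_ge0.
  rewrite -(@ler_pXn2r _ 3) ?nnegrE ?mulr_ge0 ?exprn_ge0 //.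
  apply: (@le_trans _ _ ((P ^+ 2) ^+ 2)).
    rewrite exprMn (_ : (P ^+ 2) ^+ 2 = P * P ^+ 3); last by ring.
    by rewrite ler_wpM2r ?exprn_ge0 //; lra.
  rewrite (_ : (H ^+ 2) ^+ 3 = (H ^+ 3) ^+ 2); last by ring.
  by rewrite ler_pXn2r ?nnegrE ?exprn_ge0.
have h4 : P ^+ 3 * q ^+ 4 <= H ^+ 4 * M.
  have -> : P ^+ 3 * q ^+ 4 = (P `^ (3%:R / 4%:R + eps)) ^+ 4.
    rewrite powRD ?PN0 ?implybT // exprMn (powR_exprn _ (3%:R / 4%:R)) divfK ?pnatr_eq0 //.
    by rewrite powR_mulrn.
  have -> : H ^+ 4 * M = (H * M `^ (1 / 4%:R)) ^+ 4.
    by rewrite exprMn powR_exprn divfK ?pnatr_eq0 // powRr1.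
  by rewrite ler_pXn2r ?nnegrE ?mulr_ge0 ?powR_ge0.
have M3 : P <= M ^+ 3.
  have -> : P = (P `^ (1 / 3%:R)) ^+ 3.
    by rewrite powR_exprn divfK ?pnatr_eq0 // powRr1.
  by rewrite ler_pXn2r ?nnegrE ?powR_ge0.
have P3 : 0 <= P ^+ 3 by rewrite exprn_ge0.
split=> [||_ q8].
- rewrite -(@ler_pXn2r _ 4) ?nnegrE ?mulr_ge0 //.
  rewrite (_ : (P * q) ^+ 4 = P ^+ 3 * q ^+ 4 * P); last by ring.
  rewrite (_ : (H * M) ^+ 4 = H ^+ 4 * M * M ^+ 3); last by ring.
  by rewrite ler_pM ?mulr_ge0 ?exprn_ge0.
- apply: le_trans h4; apply: ler_wpM2l => //.
  by rewrite exprS ler_peMr // exprn_ege1.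
have h2 : P ^+ 2 * q ^+ 4 <= H ^+ 4.
  rewrite -(ler_pM2r P0); apply: (@le_trans _ _ (H ^+ 4 * M)).
    by apply: le_trans h4; rewrite le_eqVlt; apply/orP; left; apply/eqP; ring.
  by rewrite ler_wpM2l ?exprn_ge0.
rewrite -(@ler_pXn2r _ 2) ?nnegrE ?mulr_ge0 ?exprn_ge0 //.
rewrite -exprM; apply: le_trans h2.
rewrite (_ : (64%:R * P) ^+ 2 = P ^+ 2 * 8%:R ^+ 4); last by ring.
by rewrite ler_wpM2l ?exprn_ge0 // ler_pXn2r ?nnegrE.
Qed.

(** With [N] the least integer such that [p < N H], the number [A = 4 N] is at
    most [8 p / H].  So [64 p <= H ^ 2] yields [A ^ 2 <= p], and the lower bounds
    on [H #|M|] and [H ^ 4 #|M|] control [A / #|M|] and [A ^ 4 / (p #|M|)]. *)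
Lemma uncovered_sqr_leq (R : realType) (p H tau : nat) (M X : {set 'F_p}) (q : R) :
  prime p -> 0 \notin M -> (0 < #|M|)%N -> (0 < H < p)%N -> (0 < tau)%N ->
  (forall u, 0 < u <= p -> size (divisors u) <= tau)%N ->
  (forall x m h, x \in X -> m \in M -> (0 < h <= H)%N -> x <> h%:R * m) ->
  1 <= q -> p%:R * q <= H%:R * #|M|%:R -> p%:R ^+ 3 * q <= H%:R ^+ 4 * #|M|%:R ->
  64%:R * p%:R <= H%:R ^+ 2 :> R ->
  #|X|%:R ^+ 2 <= 30000%:R ^+ 2 * (tau%:R ^+ 4 * q^-1) * p%:R ^+ 2.
Proof.
move=> pP M0 Mpos /andP[H0 Hp] tau0 htau uncov q1 hHM hH4M h64.
have p0 := prime_gt0 pP.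
pose N := (p %/ H).+1; pose A := (2 * N).*2.
have NH : (p <= N * H)%N by apply/ltnW/ltn_ceil.
have AH : (A * H <= 8 * p)%N.
  by have := leq_divM p H; rewrite /A /N -muln2 -!mulnA mulSn; lia.
have A2 : (A ^ 2 <= p)%N.
  have h : (64 * p <= H ^ 2)%N by rewrite -(ler_nat R) natrM natrX.
  rewrite -(@leq_pmul2r (H ^ 2)) ?expn_gt0 ?H0 // -expnMn.
  apply: (@leq_trans ((8 * p) ^ 2)); first by rewrite leq_exp2r.
  by rewrite expnMn -[(p ^ 2)%N]mulnn mulnA mulnC leq_mul2l h orbT.
have hX := uncovered_leq R pP M0 (_ : (0 < H < p)%N) (ltn0Sn _) NH uncov.
rewrite H0 Hp in hX; move: (hX isT) => {}hX; rewrite -/A in hX.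
have hE : (p * energy A M ^ 2 <= #|M| * tau ^ 2 *
    (#|M| ^ 2 * (2 * A ^ 4 + 5 * (p * A)) + 2 * (p * A) * energy A M))%N.
  apply: energy_sqr_leq => // u /andP[u0 uA]; apply: htau.
  by rewrite u0 (leq_trans (ltnW uA)).
have q0 : 0 < q by apply: lt_le_trans q1.
have H0R : 0 < H%:R :> R by rewrite ltr0n.
have P0R : 0 < p%:R :> R by rewrite ltr0n.
have AHR : A%:R * H%:R <= 8%:R * p%:R :> R by rewrite -!natrM ler_nat.
apply: (@combine_bounds R p%:R #|M|%:R A%:R (energy A M)%:R) => //.
- by rewrite ltr0n.
- by rewrite ler1n.
- by rewrite invr_ge0 (ltW q0) invf_le1.
- by move: hX; rewrite -(ler_nat R) natrM natrX !natrM.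
- by move: hE; rewrite -(ler_nat R) !(natrX, natrM, natrD).
- rewrite mulrAC ler_pdivlMr // -(ler_pM2r H0R).
  rewrite mulrAC; apply: (@le_trans _ _ (8%:R * p%:R * q)).
    by rewrite ler_wpM2r // ltW.
  by rewrite -!mulrA ler_pM2l // (mulrC #|M|%:R).
rewrite mulrAC ler_pdivlMr // -(ler_pM2r (exprn_gt0 4 H0R)).
rewrite (_ : _ * q * _ = (A%:R * H%:R) ^+ 4 * q); last by ring.
apply: (@le_trans _ _ ((8%:R * p%:R) ^+ 4 * q)).
  by rewrite ler_wpM2r ?(ltW q0) // ler_pXn2r ?nnegrE ?mulr_ge0.
rewrite (_ : _ ^+ 4 * q = 4096%:R * p%:R * (p%:R ^+ 3 * q)); last by ring.
rewrite [leRHS](_ : _ = 4096%:R * p%:R * (H%:R ^+ 4 * #|M|%:R)); last by ring.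
by rewrite ler_pM2l ?mulr_gt0.
Qed.

Theorem theorem1p1 (R : realType) (eps : R) (eps_gt0 : 0 < eps) :
  exists2 eta : R, 0 < eta &
  exists2 c : R, 0 < c &
  forall (p H : nat) (M : {set 'F_p}),
    prime p -> (1 <= H)%N -> 0 \notin M ->
    [/\ H%:R >= p%:R `^ (2%:R / 3%:R) :> R
      & H%:R * #|M|%:R >= p%:R `^ (1 + eps) :> R]
    \/
    [/\ H%:R < p%:R `^ (2%:R / 3%:R) :> R,
        #|M|%:R >= p%:R `^ (1 / 3%:R) :> R
      & H%:R * #|M|%:R `^ (1 / 4%:R) >= p%:R `^ (3%:R / 4%:R + eps) :> R] ->
    `| #|interval_prodset H M|%:R - p%:R | <= c * p%:R `^ (1 - eta).
Proof.
pose eta := eps / 4%:R; have eta0 : 0 < eta by rewrite divr_gt0.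
pose k := Num.bound (8%:R / eps).
have hk : 8%:R / eps < k%:R by rewrite archi_boundP // divr_ge0 // ltW.
have k0R : 0 < k%:R :> R by apply: lt_trans hk; rewrite divr_gt0.
have k0 : (0 < k)%N by rewrite -(ltr0n R).
have [C C0 hC] := max_divisors_bound k0.
have C0R : 0 < C%:R :> R by rewrite ltr0n.
pose D := C%:R `^ (2%:R / k%:R) : R.
pose P1 : R := 262144%:R `^ eta; pose P2 : R := (8%:R `^ (eps^-1)) `^ eta.
have D0 : 0 < D by rewrite powR_gt0.
have P10 : 0 < P1 by rewrite powR_gt0.
have P20 : 0 <= P2 by rewrite powR_ge0.
exists eta => //; exists (30000%:R * D + P1 + P2).
  by rewrite ltr_wpDr // addr_gt0 // mulr_gt0.
move=> p H M pP H0 M0 hyp.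
have p0 := prime_gt0 pP.
have p1R : 1 <= p%:R :> R by rewrite ler1n.
have p0R : 0 < p%:R :> R by rewrite ltr0n.
have pN0 : p%:R != 0 :> R by rewrite lt0r_neq0.
set X := ~: interval_prodset H M.
have cardX : (#|interval_prodset H M| + #|X| = p)%N by rewrite cardsC card_Fp.
have Xp : #|X|%:R <= p%:R :> R by rewrite ler_nat -[in leqRHS]cardX leq_addl.
have -> : `| #|interval_prodset H M|%:R - p%:R | = #|X|%:R :> R.
  by rewrite -[in p%:R]cardX natrD opprD addrA subrr sub0r normrN normr_nat.
have Mp : #|M|%:R <= p%:R :> R by rewrite ler_nat -[in leqRHS](card_Fp pP) max_card.
have [hHM hH4M hlarge] := range_consequences eps_gt0 p1R (ler0n R H) (ler0n R #|M|) Mp hyp.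
set q := p%:R `^ eps in hHM hH4M hlarge.
have q1 : 1 <= q by rewrite -(powRr0 p%:R) ler_powR // ltW.
have Mpos : (0 < #|M|)%N.
  rewrite lt0n; apply/eqP => E; move: hHM; rewrite E mulr0 leNgt.
  by rewrite mulr_gt0 // (lt_le_trans _ q1).
set Q := p%:R `^ (1 - eta).
have Q0 : 0 < Q by rewrite powR_gt0.
have pQ : p%:R = p%:R `^ eta * Q by rewrite -powRD ?pN0 ?implybT // addrC subrK powRr1.
(* The trivial bound #|X| <= p suffices when p is bounded in terms of eps. *)
have small B : p%:R <= B -> #|X|%:R <= B `^ eta * Q.
  move=> pB; apply: (le_trans Xp); rewrite {1}pQ ler_wpM2r ?(ltW Q0) //.
  by rewrite ge0_ler_powR ?nnegrE ?(ltW eta0) // (le_trans _ pB).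
have c1 : 0 <= 30000%:R * D * Q by rewrite !mulr_ge0 // ltW.
have c2 : 0 <= P1 * Q by rewrite mulr_ge0 // ltW.
have c3 : 0 <= P2 * Q by rewrite mulr_ge0 // ltW.
rewrite 2!mulrDl.
have [/ltW/small|p262] := ltP p%:R (262144%:R : R); first by rewrite -/P1; lra.
have [q8|q8] := ltP q 8%:R.
  suff /small : p%:R <= 8%:R `^ eps^-1 :> R by rewrite -/P2; lra.
  rewrite -[leLHS](powRr1 (ltW p0R)) -[X in _ `^ X <= _](divff (lt0r_neq0 eps_gt0)) powRrM.
  apply: ge0_ler_powR; rewrite ?nnegrE ?powR_ge0 //; last exact: ltW.
  by rewrite invr_ge0 ltW.
have [pH|Hp] := leqP p H.
  have XE : #|X| = 0%N.
    by rewrite /X (interval_prodset_full pP M0 Mpos pH) setCT cards0.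
  by rewrite XE; lra.
have [tau [tau0 tauk htau]] := hC p p0.
have uncov x m h : x \in X -> m \in M -> (0 < h <= H)%N -> x <> h%:R * m.
  by rewrite inE => /negP xX mM hH xE; apply: xX; rewrite xE interval_prodset_mem.
have HH : (0 < H < p)%N by rewrite H0.
have := uncovered_sqr_leq pP M0 Mpos HH tau0 htau uncov q1 hHM hH4M (hlarge p262 q8).
have ht : tau%:R ^+ 2 <= D * p%:R `^ eta :> R.
  have -> : tau%:R ^+ 2 = (tau%:R ^+ k) `^ (2%:R / k%:R) :> R.
    by rewrite -[in RHS]powR_mulrn // -powRrM mulrC divfK ?lt0r_neq0 // powR_mulrn.
  apply: (@le_trans _ _ ((C%:R * p%:R) `^ (2%:R / k%:R))).
    rewrite ge0_ler_powR ?nnegrE ?divr_ge0 ?mulr_ge0 ?exprn_ge0 //.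
    by rewrite -natrX -natrM ler_nat.
  rewrite powRM // -/D ler_pM2l // ler_powR // /eta ler_pdivrMr //.
  by move: hk; rewrite ltr_pdivrMr //; lra.
move=> hX.
suff : #|X|%:R <= 30000%:R * D * Q by lra.
rewrite -(@ler_pXn2r _ 2) ?nnegrE //; apply: (le_trans hX).
have qE : (p%:R `^ eta) ^+ 2 * q^-1 * p%:R ^+ 2 = Q ^+ 2.
  rewrite /q -powRN -[in p%:R ^+ 2]powR_mulrn // !powR_exprn.
  by rewrite -!powRD ?pN0 ?implybT //; congr (_ `^ _); rewrite /eta; field.
rewrite exprMn -qE exprMn.
rewrite [leRHS](_ : _ = 30000%:R ^+ 2 * ((D * p%:R `^ eta) ^+ 2 * q^-1) * p%:R ^+ 2); last by ring.
rewrite ler_wpM2r ?sqr_ge0 // ler_wpM2l ?sqr_ge0 // ler_wpM2r ?invr_ge0 ?(le_trans _ q1) //.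
rewrite (_ : tau%:R ^+ 4 = (tau%:R ^+ 2) ^+ 2 :> R); last by ring.
by rewrite ler_pXn2r ?nnegrE ?sqr_ge0 // mulr_ge0 // ?powR_ge0 // ltW.
Qed.
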